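(* For each integer $n\ge1$ let $\tilde g_n(x)=\dfrac{n x^{n-1}}{x^n+i}$, which is a function of the form $\sum_{k=1}^n\frac{1}{x-z_k}$ with $|z_1|=\dots=|z_n|=1$. Then: (i) for every real $p>0$ and every $n\ge1$, $$\int_{-1}^1|\tilde g_n(x)|^p\,dx\le \tilde C_p\,n^{p-1},\qquad \tilde C_p=\int_0^1\frac{2t^{\kappa}\,dt}{(t^2+1)^{p/2}},\quad \kappa=\min\{p-1,0\};$$ (ii) for every $0<\delta<1/2$ and every $n\ge1$, $$\mu\big(\{x\in[-1,1]:\ |\mathrm{Re}(x\tilde g_n(x))|\ge\delta n\}\big)<\tilde K n^{-1},\qquad \tilde K=\ln(\delta^{-1}-1)>0.$$ (Hence the order in $n$ of a general lower bound $\int_{-1}^1|g_n|^p\,dx>C_p n^{p-1}$, and of a general lower bound $\mu(\{x\in[-1,1]:|\mathrm{Re}(xg_n(x))|\ge\delta n\})\ge K(\delta)n^{-1}$, over all $g_n(z)=\sum_{k=1}^n (z-z_k)^{-1}$ with $|z_k|=1$, cannot be improved.)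
   Context: $\mu$ denotes the Lebesgue measure on $\mathbb{R}$; $i$ is the imaginary unit. *)

(* Defs.v *)
From HB Require Import structures.
From mathcomp Require Import all_boot all_order all_algebra.
From mathcomp Require Import all_classical all_reals all_analysis.
From mathcomp.real_closed Require Import complex.

Set Implicit Arguments.
Unset Strict Implicit.
Unset Printing Implicit Defensive.

Import Order.TTheory GRing.Theory Num.Theory.
Import numFieldNormedType.Exports.

Local Open Scope classical_set_scope.
Local Open Scope ring_scope.
Local Open Scope complex_scope.

(* The norm of [R[i]] takes its values in [R[i]]; this is the modulus as a
   real number. *)
Definition cmod (R : realType) (w : R[i]) : R := complex.Re `|w|.

(* At a pole, the convention [0^-1 = 0] drops the corresponding summand. *)
Definition pole_sum (R : realType) (n : nat) (z : 'I_n -> R[i]) (w : R[i])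
  : R[i] := \sum_(k < n) (w - z k)^-1.

Definition unimodular (R : realType) (n : nat) (z : 'I_n -> R[i]) : Prop :=
  forall k : 'I_n, cmod (z k) = 1.

Definition gtilde (R : realType) (n : nat) (w : R[i]) : R[i] :=
  n%:R * w ^+ n.-1 / (w ^+ n + (0 +i* 1)).

Definition int_pow (R : realType) (p : R) (g : R[i] -> R[i]) : \bar R :=
  \int[@lebesgue_measure R]_(x in `[-1, 1]) (cmod (g x%:C) `^ p)%:E.

Definition meas_large (R : realType) (c : R) (g : R[i] -> R[i]) : \bar R :=
  @lebesgue_measure R
    [set x | x \in `[-1, 1] /\ c <= `|complex.Re (x%:C * g x%:C)|].

(* For [p < 1] the integrand is singular at [0]; the value [0 `^ kappa = 0]
   given to it there does not affect the integral. *)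
Definition Ctilde (R : realType) (p : R) : \bar R :=
  \int[@lebesgue_measure R]_(t in `[0, 1])
    (2 * t `^ Num.min (p - 1) 0 / (t ^+ 2 + 1) `^ (p / 2))%:E.

Definition Ktilde (R : realType) (delta : R) : R := ln (delta^-1 - 1).

(* Main.v *)
Require Import Defs.
From HB Require Import structures.
From mathcomp Require Import all_boot all_order all_algebra.
From mathcomp Require Import all_classical all_reals all_analysis.
From mathcomp.real_closed Require Import complex.
From mathcomp Require Import measurable_realfun ring lra.

Set Implicit Arguments.
Unset Strict Implicit.
Unset Printing Implicit Defensive.

Import Order.TTheory GRing.Theory Num.Theory.
Import numFieldNormedType.Exports.

Local Open Scope classical_set_scope.
Local Open Scope ring_scope.
Local Open Scope complex_scope.

(** For real [x] the denominator [x ^+ n + 'i] has real part [x ^+ n] and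
    imaginary part [1], so everything about [gtilde n] on the real line is
    explicit in [t = x ^+ n]:
      [|gtilde n x| = n |x| ^ (n-1) / sqrt (t ^ 2 + 1)]   ([cmod_gtilde]),
      [Re (x * gtilde n x) = n * (t ^ 2 / (t ^ 2 + 1))]   ([Re_mul_gtilde]).

    Moment bound.  The integrand is even, so only [0 < x <= 1] matters.  There
    [|x ^ (n-1)| ^ p <= t ^ kappa * x ^ (n-1)] with [kappa = min (p - 1) 0], hence
    [2 |gtilde n x| ^ p] is at most [n ^ (p-1)] times the integrand of [Ctilde p]
    taken at [t], times [dt/dx] ([cmod_gtilde_powR_le]); the substitution
    [t = x ^+ n] then yields [Ctilde p * n ^ (p-1)] ([int_pow_gtilde]).  For
    [p < 1] the integrand of [Ctilde p] blows up at [0], so all integrals are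
    first taken over [a <= |x|] with [0 < a], where everything is continuous, and
    then [a] tends to [0] by monotone convergence ([integral_le_away_from0]).

    Measure bound.  The condition [delta * n <= |Re (x * gtilde n x)|] says
    [x ^ (2n) >= delta / (1 - delta) = exp (- Ktilde delta)], that is [s <= |x|]
    with [s = exp (- Ktilde delta / (2n))] ([large_setE]).  The measure of this
    set in [[-1, 1]] is [2 (1 - s)], and [1 - u < exp (- u)] for [u != 0] makes it
    less than [Ktilde delta / n].

    Optimality.  [gtilde n] is the logarithmic derivative of ['X^n + 'i], whose
    roots are unimodular ([gtilde_pole_sum]), so it is one of the sums over which
    the general lower bounds are taken, and the upper bounds apply to it. *)

(** * The rational function on the real line *)

Lemma cmodM (R : realType) (u v : R[i]) : cmod (u * v) = cmod u * cmod v.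
Proof. exact: ComplexField.Normc.normcM. Qed.

Lemma cmodV (R : realType) (u : R[i]) : cmod u^-1 = (cmod u)^-1.
Proof. exact: ComplexField.Normc.normcV. Qed.

Lemma cmodE (R : realType) (x y : R) :
  cmod (x +i* y) = Num.sqrt (x ^+ 2 + y ^+ 2).
Proof. by rewrite /cmod normc_def. Qed.

Lemma cmod_real (R : realType) (x : R) : cmod x%:C = `|x|.
Proof. by rewrite cmodE expr0n addr0 sqrtr_sqr. Qed.

Lemma cmod1 (R : realType) : cmod (1 : R[i]) = 1.
Proof. by rewrite -[1]/(1%:C) cmod_real normr1. Qed.

Lemma cmodX (R : realType) (u : R[i]) n : cmod (u ^+ n) = cmod u ^+ n.
Proof.
by elim: n => [|n IHn]; rewrite ?expr0 ?cmod1 // !exprS cmodM IHn.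
Qed.

Lemma cmod_ge0 (R : realType) (u : R[i]) : 0 <= cmod u.
Proof. by case: u => a b; rewrite cmodE sqrtr_ge0. Qed.

Lemma real_denomE (R : realType) (n : nat) (x : R) :
  x%:C ^+ n + (0 +i* 1) = x ^+ n +i* 1.
Proof.
by rewrite -rmorphXn; apply/eqP; rewrite eq_complex /= addr0 add0r !eqxx.
Qed.

Lemma real_not_pole (R : realType) (n : nat) (x : R) :
  x%:C ^+ n + (0 +i* 1) != 0.
Proof. by rewrite real_denomE eq_complex /= oner_eq0 andbF. Qed.

Lemma cmod_gtilde (R : realType) (n : nat) (x : R) :
  cmod (gtilde n x%:C) =
  n%:R * `|x| ^+ n.-1 / Num.sqrt ((x ^+ n) ^+ 2 + 1).
Proof.
rewrite /gtilde real_denomE !(cmodM, cmodV, cmodX) cmod_real cmodE expr1n.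
by rewrite -(rmorph_nat (real_complex R)) cmod_real normr_nat.
Qed.

Lemma Re_mul_gtilde (R : realType) (n : nat) (x : R) : (0 < n)%N ->
  complex.Re (x%:C * gtilde n x%:C) =
  n%:R * ((x ^+ n) ^+ 2 / ((x ^+ n) ^+ 2 + 1)).
Proof.
move=> n0; rewrite /gtilde real_denomE mulrA mulrCA -exprS prednK //.
rewrite -rmorphXn -(rmorph_nat (real_complex R)) -rmorphM /=.
by rewrite mul0r subr0 expr1n -!mulrA expr2 !mulrA.
Qed.

Lemma cmod_gtildeN (R : realType) (n : nat) (x : R) :
  cmod (gtilde n (- x)%:C) = cmod (gtilde n x%:C).
Proof.
have sqN : (- x) ^+ n ^+ 2 = x ^+ n ^+ 2 by rewrite -!exprM mulnC !exprM sqrrN.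
by rewrite [LHS]cmod_gtilde normrN sqN -cmod_gtilde.
Qed.

Lemma cmod_gtilde_gt0 (R : realType) (n : nat) (x : R) :
  (0 < n)%N -> x != 0 -> 0 < cmod (gtilde n x%:C).
Proof.
move=> n0 x0; rewrite cmod_gtilde divr_gt0 //.
  by rewrite mulr_gt0 ?ltr0n // exprn_gt0 // normr_gt0.
by rewrite sqrtr_gt0 ltr_wpDl // sqr_ge0.
Qed.

(** * Partial fractions *)

Lemma logderiv_prod_XsubC (F : fieldType) (s : seq F) (w : F) :
  (\prod_(z <- s) ('X - z%:P)).[w] != 0 ->
  (\prod_(z <- s) ('X - z%:P))^`().[w] / (\prod_(z <- s) ('X - z%:P)).[w] =
  \sum_(z <- s) (w - z)^-1.
Proof.
elim: s => [|z s IHs]; first by rewrite !big_nil derivC horner0 mul0r.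
rewrite !big_cons hornerM mulf_eq0 negb_or => /andP[wz ws].
rewrite derivM derivXsubC mul1r hornerD hornerM -IHs //.
rewrite hornerXsubC in wz *.
by field; rewrite wz ws.
Qed.

(** Over the algebraically closed field [R[i]] the polynomial ['X^n + 'i] splits;
    each root satisfies [z k ^+ n = - 'i], hence [|z k| = 1]. *)
Lemma gtilde_pole_sum (R : realType) (n : nat) : (0 < n)%N ->
  exists z : 'I_n -> R[i], unimodular z /\
    forall w : R[i], w ^+ n + (0 +i* 1) != 0 -> gtilde n w = pole_sum z w.
Proof.
move=> n0; pose q : {poly R[i]} := 'X^n + (0 +i* 1)%:P.
have szq : size q = n.+1.
  by rewrite /q size_polyDl size_polyXn // size_polyC; case: eqP => //= _; rewrite ltnS.
have mq : lead_coef q = 1.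
  rewrite /lead_coef szq /= /q coefD coefXn eqxx coefC.
  by rewrite (gtn_eqF n0) addr0.
have [s] := closed_field_poly_normal q; rewrite mq scale1r => qE.
have szs : size s = n.
  by apply: succn_inj; rewrite -szq qE size_prod_XsubC.
have qw w : q.[w] = w ^+ n + (0 +i* 1).
  by rewrite /q hornerD hornerXn hornerC.
exists (fun k => nth 0 s k); split => [k|w w0].
  have : root q (nth 0 s k) by rewrite qE root_prod_XsubC mem_nth ?szs.
  rewrite /root qw addr_eq0 => /eqP/(congr1 (@cmod R)).
  rewrite cmodX => zE; apply/eqP; rewrite -(pexpr_eq1 n0 (cmod_ge0 _)) zE.
  apply/eqP.
  by rewrite -[- _]/((- 0) +i* (- 1)) cmodE !sqrrN expr0n add0r expr1n sqrtr1.
rewrite /pole_sum -(big_mkord xpredT (fun k => (w - nth 0 s k)^-1)) -szs.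
rewrite -(big_nth 0 xpredT (fun z => (w - z)^-1)).
rewrite -logderiv_prod_XsubC -qE qw // /gtilde szs; congr (_ / _).
by rewrite /q derivD derivC addr0 derivXn hornerMn hornerXn mulr_natl.
Qed.

(** * The set where the real part is large *)

Lemma Ktilde_gt0 (R : realType) (delta : R) :
  0 < delta -> delta < 1 / 2 -> 0 < Ktilde delta.
Proof.
move=> d0 d1; apply: ln_gt0; rewrite ltrBrDr.
have -> : 1 + 1 = 2 :> R by ring.
by rewrite -[ltLHS]invrK ltf_pV2 ?posrE ?invr_gt0 // -div1r.
Qed.

(** With [y = x ^ (2n)], the condition [delta <= y / (y + 1)] is
    [delta / (1 - delta) <= y], and [s] is the [2n]-th root of the left-hand
    side. *)
Lemma large_setE (R : realType) (delta : R) (n : nat) :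
  0 < delta -> delta < 1 / 2 -> (0 < n)%N ->
  let s := expR (- (Ktilde delta / (2 * n%:R))) in
  [set x : R | x \in `[-1, 1] /\
     delta * n%:R <= `|complex.Re (x%:C * gtilde n x%:C)|] =
  `[-1, - s] `|` `[s, 1].
Proof.
move=> d0 d1 n0 s.
have nR : 0 < n%:R :> R by rewrite ltr0n.
have s0 : 0 < s by exact: expR_gt0.
have s1 : s < 1.
  by rewrite expR_lt1 oppr_lt0 divr_gt0 ?mulr_gt0 // Ktilde_gt0.
have dpos : 0 < delta^-1 - 1.
  have : 0 < Ktilde delta by exact: Ktilde_gt0.
  by apply: contraTT; rewrite -!leNgt => /ln0; rewrite /Ktilde => ->.
have sX : s ^+ (n * 2) = delta / (1 - delta).
  rewrite -expRM_natl natrM.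
  rewrite (_ : _ * _ = - Ktilde delta); last by field; rewrite gt_eqF.
  rewrite expRN /Ktilde lnK ?posrE //; field.
  by rewrite !gt_eqF //= subr_gt0; lra.
have key x : (delta * n%:R <= `|complex.Re (x%:C * gtilde n x%:C)|) = (s <= `|x|).
  rewrite Re_mul_gtilde //.
  have y0 : 0 <= (x ^+ n) ^+ 2 by exact: sqr_ge0.
  rewrite ger0_norm; last by rewrite mulr_ge0 // divr_ge0 // addr_ge0.
  have n2 : (0 < n * 2)%N by rewrite muln_gt0 n0.
  rewrite mulrC ler_pM2l // -[RHS](ler_pXn2r n2) ?nnegrE ?(ltW s0) //.
  rewrite sX exprM -normrX -normrX ger0_norm //.
  rewrite ler_pdivlMr; last by lra.
  by rewrite ler_pdivrMr; [apply/idP/idP; lra|lra].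
apply/seteqP; split => [x [xI]|x]; rewrite /= ?key.
  move: xI; rewrite !in_itv /= => /andP[x1 x2] sx.
  have [x0|x0] := leP 0 x.
    by right; rewrite x2 andbT -(ger0_norm x0).
  by left; rewrite x1 -(opprK x) lerN2 -(ltr0_norm x0).
rewrite !in_itv /= => -[] /andP[x1 x2]; split.
- by apply/andP; split; lra.
- by rewrite ltr0_norm; lra.
- by apply/andP; split; lra.
- by rewrite ger0_norm; lra.
Qed.

Lemma meas_large_gtilde (R : realType) (delta : R) (n : nat) :
  0 < delta -> delta < 1 / 2 -> (0 < n)%N ->
  (meas_large (delta * n%:R) (@gtilde R n) < (Ktilde delta * n%:R^-1)%:E)%E.
Proof.
move=> d0 d1 n0; rewrite /meas_large large_setE //=.
have nR : 0 < n%:R :> R by rewrite ltr0n.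
have K0 := Ktilde_gt0 d0 d1.
set s := expR _.
have s1 : s < 1 by rewrite expR_lt1 oppr_lt0 divr_gt0 ?mulr_gt0.
have sK : 1 - Ktilde delta / (2 * n%:R) < s.
  by apply: expR_gt1Dx; rewrite oppr_eq0 gt_eqF // divr_gt0 ?mulr_gt0.
pose A : set R := `[-1, - s]%classic; pose B : set R := `[s, 1]%classic.
have : (lebesgue_measure (A `|` B) <= lebesgue_measure A + lebesgue_measure B)%E.
  by apply: measureU2; exact: measurable_itv.
move=> /le_lt_trans; apply.
rewrite !lebesgue_measure_itv /= !lte_fin ltrN2 s1 -!EFinD lte_fin.
have -> : Ktilde delta / n%:R = 2 * (Ktilde delta / (2 * n%:R)).
  by field; rewrite gt_eqF.
lra.
Qed.

(** * Integrals of functions singular at the origin *)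

(** By monotone convergence along [D] minus the interval of radius [1/(k+2)]
    about [0]; the origin itself is a null set. *)
Lemma integral_le_away_from0 (R : realType) (D : set R) (f : R -> \bar R)
    (M : \bar R) :
  measurable D -> measurable_fun D f -> (forall x, D x -> (0 <= f x)%E) ->
  (forall a : R, 0 < a -> a < 1 ->
     (\int[@lebesgue_measure R]_(x in D `&` [set x | (a <= `|x|)%R]) f x <= M)%E) ->
  (\int[@lebesgue_measure R]_(x in D) f x <= M)%E.
Proof.
move=> mD mf f0 fM.
have mD0 : measurable (D `\ 0) by exact: measurableD.
rewrite -(@integral_setD1 _ _ 0) //; last exact: measurable_funS mf.
pose F k := D `&` [set x : R | ((k.+2)%:R^-1 <= `|x|)%R].
have mA (a : R) : measurable [set x : R | (a <= `|x|)%R].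
  rewrite (_ : [set _ | _] = Num.norm @^-1` `[a, +oo[%classic).
    rewrite -[_ @^-1` _]setTI; exact: normr_measurable.
  by apply/seteqP; split => x /=; rewrite in_itv /= andbT.
have FE : \bigcup_k F k = D `\ 0.
  apply/seteqP; split => [x [k _ [Dx /= kx]]|x [Dx x0]].
    split => // x0; move: kx; rewrite x0 normr0 leNgt invr_gt0 ltr0n //.
  have x0' : 0 < `|x| by rewrite normr_gt0; apply/eqP.
  exists (Num.truncn `|x|^-1) => //; split => //=.
  rewrite -[leRHS]invrK lef_pV2 ?posrE ?invr_gt0 //.
  apply/ltW; apply: lt_trans (truncnS_gt _) _; by rewrite ltr_nat.
have ndF : nondecreasing_seq F.
  move=> i j ij; apply/subsetPset => x [Dx /= ix]; split => //=.
  by apply: le_trans ix; rewrite lef_pV2 ?posrE // ler_nat !ltnS.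
have /cvge_to_le : (\int[@lebesgue_measure R]_(x in F k) f x)%E
    @[k --> \oo] --> (\int[@lebesgue_measure R]_(x in \bigcup_k F k) f x)%E.
  apply: ge0_nondecreasing_set_cvg_integral => //.
  - by move=> i; apply: measurableI => //; exact: mA.
  - by move=> i; apply: measurable_funS mf => // x [].
  - by move=> i x [Dx _]; exact: f0.
rewrite -FE; apply.
by apply: nearW => k; apply: fM; rewrite ?invr_gt0 ?invf_lt1 ?ltr0n ?ltr1n.
Qed.

Lemma setI_itv01_away (R : realType) (a : R) : 0 < a ->
  `[0, 1] `&` [set x : R | a <= `|x|] = `[a, 1]%classic.
Proof.
move=> a0; apply/seteqP; split => x /=; rewrite !in_itv /=.
  by move=> [/andP[x0 ->]]; rewrite ger0_norm // andbT.
by move=> /andP[ax ->]; rewrite ger0_norm; lra.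
Qed.

Lemma setI_itvN11_away (R : realType) (a : R) : 0 < a ->
  `[-1, 1] `&` [set x : R | a <= `|x|] = `[-1, - a] `|` `[a, 1].
Proof.
move=> a0; apply/seteqP; split => x /=; rewrite !in_itv /=.
  move=> [/andP[x1 x2]]; have [x0|x0] := leP 0 x.
    by rewrite ger0_norm // => ax; right; apply/andP.
  by rewrite ltr0_norm // => ax; left; apply/andP; split; lra.
move=> [] /andP[x1 x2]; split.
- by lra.
- by rewrite ltr0_norm; lra.
- by lra.
- by rewrite ger0_norm; lra.
Qed.

(** Reflecting [[-1, -a]] onto [[a, 1]] doubles the integral.  Continuity away
    from [0] is what a power of a function positive there provides. *)
Lemma integral_even_le (R : realType) (f : R -> R) (M : \bar R) :
  measurable_fun [set: R] f -> (forall x, 0 <= f x) ->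
  (forall x, f (- x) = f x) ->
  (forall x, x != 0 -> {for x, continuous f}) ->
  (forall a : R, 0 < a -> a < 1 ->
     (\int[@lebesgue_measure R]_(x in `[a, 1%R]) (2 * f x)%:E <= M)%E) ->
  (\int[@lebesgue_measure R]_(x in `[(-1)%R, 1%R]) (f x)%:E <= M)%E.
Proof.
move=> mf f0 evenf cf fM.
have mfE D : measurable D -> measurable_fun D (fun x : R => (f x)%:E).
  by move=> mD; apply/measurable_EFinP; exact: measurable_funS mf.
apply: integral_le_away_from0 => //.
- by apply: mfE; exact: measurable_itv.
- by move=> x _; rewrite lee_fin.
move=> a a0 a1; rewrite setI_itvN11_away //.
rewrite ge0_integral_setU //; last 3 first.
- by apply: mfE; exact: measurableU.
- by move=> x _; rewrite lee_fin.
- by apply/disj_setPS => x [] /=; rewrite !in_itv /=; lra.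
rewrite (@integration_by_substitution_oppr R f a 1 (ltW a1)); last first.
  apply: continuous_in_subspaceT => x; rewrite inE /= in_itv /= => /andP[_ xa].
  by apply: cf; rewrite lt_eqF //; lra.
have -> : f \o -%R = f by apply/funext => x; exact: evenf.
rewrite -ge0_integralD //; last 4 first.
- by move=> x _; rewrite lee_fin.
- by apply: mfE; exact: measurable_itv.
- by move=> x _; rewrite lee_fin.
- by apply: mfE; exact: measurable_itv.
under eq_integral do rewrite -EFinD -mulr2n -mulr_natl.
exact: fM.
Qed.

Lemma continuous_powR_gt0 (R : realType) (r x : R) : 0 < x ->
  {for x, continuous (fun y : R => y `^ r)}.
Proof.
move=> x0; apply: differentiable_continuous; apply/derivable1_diffP.
by apply: derivable_powR; rewrite in_itv /= x0.
Qed.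

Lemma continuous_powR_comp (R : realType) (g : R -> R) (p x : R) :
  {for x, continuous g} -> 0 < g x -> {for x, continuous (fun y => g y `^ p)}.
Proof.
move=> cg gx0.
by apply: (@continuous_comp _ _ _ g (fun y => y `^ p)) => //; exact: continuous_powR_gt0.
Qed.

Lemma within_itv_continuous_gt0 (R : realType) (f : R -> R) (a b : R) :
  0 < a -> (forall x, 0 < x -> {for x, continuous f}) ->
  {within `[a, b], continuous f}.
Proof.
move=> a0 cf; apply: continuous_in_subspaceT => x; rewrite inE /= in_itv /=.
by move=> /andP[ax _]; apply: cf; exact: lt_le_trans ax.
Qed.

(** The primitive [x ^ (k+1) / (k+1)] is nonnegative at [a] because [-1 < k], so
    the bound is uniform in [a]. *)
Lemma integral_powR_le (R : realType) (k a : R) : -1 < k -> 0 < a -> a < 1 ->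
  (\int[@lebesgue_measure R]_(x in `[a, 1%R]) (x `^ k)%:E <= ((k + 1)^-1)%:E)%E.
Proof.
move=> k1 a0 a1.
have k10 : 0 < k + 1 by lra.
pose F (x : R) := (k + 1)^-1 * x `^ (k + 1).
have dF (x : R) : 0 < x -> is_derive x 1 F (x `^ k).
  move=> x0; have := is_derive1_powR (k + 1) x0; rewrite addrK => dx.
  have := is_deriveZ (k + 1)^-1 dx.
  by rewrite /GRing.scale /= mulrA mulVf ?mul1r // gt_eqF.
have cF (x : R) : 0 < x -> {for x, continuous F}.
  by move=> x0; apply: cvgM; [exact: cvg_cst|exact: continuous_powR_gt0].
rewrite (@continuous_FTC2 _ _ F) //.
- rewrite -EFinB lee_fin /F powR1 mulr1 lerBlDr lerDl.
  by rewrite mulr_ge0 ?powR_ge0 // invr_ge0 ltW.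
- apply: within_itv_continuous_gt0 => // x; exact: continuous_powR_gt0.
- split=> [x||].
  + rewrite in_itv /= => /andP[ax _].
    by have /dF[] : 0 < x by exact: lt_trans ax.
  + by apply: cvg_at_right_filter; exact: cF.
  + by apply: cvg_at_left_filter; exact: cF.
- move=> x; rewrite in_itv /= => /andP[ax _].
  have /dF[_ dx] : 0 < x by exact: lt_trans ax.
  by rewrite derive1E.
Qed.

(** * The integral defining the constant *)

Definition Ctilde_integrand (R : realType) (p t : R) : R :=
  2 * t `^ Num.min (p - 1) 0 / (t ^+ 2 + 1) `^ (p / 2).

Lemma Ctilde_integrand_ge0 (R : realType) (p t : R) : 0 <= Ctilde_integrand p t.
Proof. by rewrite divr_ge0 ?mulr_ge0 ?powR_ge0. Qed.

Lemma continuous_Ctilde_integrand (R : realType) (p t : R) : 0 < t ->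
  {for t, continuous (Ctilde_integrand p)}.
Proof.
move=> t0.
have d0 : 0 < t ^+ 2 + 1 by rewrite ltr_wpDl // sqr_ge0.
have cden : {for t, continuous ((fun y => y `^ (p / 2)) \o (fun y => y ^+ 2 + 1))}.
  apply: continuous_comp; last exact: continuous_powR_gt0.
  by apply: cvgD; [exact: exprn_continuous|exact: cvg_cst].
apply: cvgM; first by apply: cvgM; [exact: cvg_cst|exact: continuous_powR_gt0].
by apply: cvgV; [rewrite gt_eqF // powR_gt0|exact: cden].
Qed.

Lemma measurable_Ctilde_integrand (R : realType) (p : R) :
  measurable_fun [set: R] (Ctilde_integrand p).
Proof.
apply: measurable_funM; first exact: measurable_funM.
have mden : measurable_fun [set: R] (fun t : R => (t ^+ 2 + 1) `^ (- (p / 2))).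
  apply: (measurableT_comp (measurable_powR _)).
  exact: measurable_funD.
by apply: eq_measurable_fun mden => t _; rewrite powRN.
Qed.

(** The denominator is at least [1], so the integrand is dominated by
    [2 * t ^ kappa], where [kappa > -1] because [0 < p]. *)
Lemma Ctilde_lty (R : realType) (p : R) : 0 < p -> (Ctilde p < +oo)%E.
Proof.
move=> p0; pose k := Num.min (p - 1) 0.
have k1 : -1 < k by rewrite /k lt_min; apply/andP; split; lra.
apply: (@le_lt_trans _ _ (2 * (k + 1)^-1)%:E); last exact: ltry.
apply: integral_le_away_from0 => //.
- apply/measurable_EFinP; apply: measurable_funS (measurable_Ctilde_integrand p) => //.
- by move=> x _; rewrite lee_fin Ctilde_integrand_ge0.
move=> a a0 a1; rewrite setI_itv01_away //.
rewrite EFinM; apply: le_trans (lee_wpmul2l _ (integral_powR_le k1 a0 a1)); last by rewrite lee_fin.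
rewrite -ge0_integralZl //; last 2 first.
- by apply/measurable_EFinP; apply: measurable_funS (measurable_powR _).
- by move=> x _; rewrite lee_fin powR_ge0.
apply: ge0_le_integral => //.
- by move=> x _; rewrite lee_fin Ctilde_integrand_ge0.
- by apply/measurable_EFinP; apply: measurable_funS (measurable_Ctilde_integrand p).
- apply: measurable_funeM; apply/measurable_EFinP.
  by apply: measurable_funS (measurable_powR _).
move=> x; rewrite /= in_itv /= => /andP[ax _].
rewrite -EFinM lee_fin ler_pdivrMr; last by rewrite powR_gt0 // ltr_wpDl // sqr_ge0.
rewrite ler_peMr ?mulr_ge0 ?powR_ge0 //.
rewrite -[leLHS](powRr0 (x ^+ 2 + 1)); apply: ler_powR.
  by rewrite lerDr sqr_ge0.
by rewrite divr_ge0 // ltW.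
Qed.

(** The substitution [t = x ^+ n] turns the left-hand side into the integral over
    the part [[a ^+ n, 1]] of the range of integration of [Ctilde p]. *)
Lemma integral_Ctilde_integrand_exprn (R : realType) (p a : R) (n : nat) :
  (0 < n)%N -> 0 < a -> a < 1 ->
  (\int[@lebesgue_measure R]_(x in `[a, 1%R])
     (Ctilde_integrand p (x ^+ n) * (n%:R * x ^+ n.-1))%:E <= Ctilde p)%E.
Proof.
move=> n0 a0 a1.
have dX : (fun x : R => x ^+ n)^`()%classic = fun x => n%:R * x ^+ n.-1.
  by apply/funext => x; rewrite exp_derive1.
have cdX (x : R) : {for x, continuous (fun x : R => n%:R * x ^+ n.-1)}.
  by apply: cvgM; [exact: cvg_cst|exact: exprn_continuous].
have := @integration_by_substitution_increasing R (fun x => x ^+ n) (Ctilde_integrand p) a 1.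
rewrite dX expr1n => <-; last 7 first.
- exact: ltW.
- move=> x y; rewrite !in_itv /= => /andP[ax _] /andP[ay _] xy.
  by rewrite ltr_pXn2r ?nnegrE // ltW // (lt_le_trans a0).
- by move=> x _; exact: cdX.
- by apply: cvgP; apply: cvg_at_right_filter; exact: cdX.
- by apply: cvgP; apply: cvg_at_left_filter; exact: cdX.
- split=> [x _||]; first exact: exprn_derivable.
  + by apply: cvg_at_right_filter; exact: exprn_continuous.
  + by apply: cvg_at_left_filter; exact: exprn_continuous.
- apply: within_itv_continuous_gt0; first exact: exprn_gt0.
  by move=> x; exact: continuous_Ctilde_integrand.
apply: ge0_subset_integral => //.
- by apply/measurable_EFinP; apply: measurable_funS (measurable_Ctilde_integrand p).
- by move=> x _; rewrite lee_fin Ctilde_integrand_ge0.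
move=> x; rewrite /= !in_itv /= => /andP[ax ->]; rewrite andbT.
by apply: le_trans ax; rewrite exprn_ge0 // ltW.
Qed.

(** * The moment bound *)

Lemma continuous_cmod_gtilde (R : realType) (n : nat) :
  continuous (fun x : R => cmod (gtilde n x%:C)).
Proof.
move=> x; rewrite (_ : (fun _ => _) = fun y : R =>
    n%:R * `|y| ^+ n.-1 / Num.sqrt ((y ^+ n) ^+ 2 + 1)); last first.
  by apply/funext => y; rewrite cmod_gtilde.
have cpow : {for x, continuous ((fun y : R => y ^+ n.-1) \o Num.norm)}.
  by apply: continuous_comp; [exact: norm_continuous|exact: exprn_continuous].
have csqr : {for x, continuous ((fun y : R => y ^+ 2) \o (fun y => y ^+ n))}.
  by apply: continuous_comp; exact: exprn_continuous.
have csqrt : {for x, continuous (Num.sqrt \o (fun y : R => (y ^+ n) ^+ 2 + 1))}.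
  apply: continuous_comp; last exact: sqrt_continuous.
  by apply: cvgD; [exact: csqr|exact: cvg_cst].
apply: cvgM; first by apply: cvgM; [exact: cvg_cst|exact: cpow].
apply: cvgV; last exact: csqrt.
by rewrite gt_eqF // sqrtr_gt0 ltr_wpDl // sqr_ge0.
Qed.

(** Writing [u = x ^ (n-1)], after division by [u] this is
    [u ^ (p-1) <= (x ^+ n) ^ kappa] with [kappa = min (p - 1) 0]: if [1 <= p] the
    right-hand side is [1]; if [p < 1] both exponents equal
    [p - 1 < 0] and [x ^+ n <= u]. *)
Lemma powR_exprn_le (R : realType) (p x : R) (n : nat) :
  (0 < n)%N -> 0 < x -> x <= 1 ->
  (x ^+ n.-1) `^ p <= (x ^+ n) `^ Num.min (p - 1) 0 * x ^+ n.-1.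
Proof.
move=> n0 x0 x1; set u := x ^+ n.-1.
have u0 : 0 < u by exact: exprn_gt0.
have u1 : u <= 1 by rewrite exprn_ile1 // ltW.
have xn : x ^+ n <= u by rewrite -(prednK n0) exprS ler_piMl // ltW.
have xn0 : 0 < x ^+ n by exact: exprn_gt0.
rewrite -[X in u `^ X](subrK 1) powRD; last by rewrite (gt_eqF u0) implybT.
rewrite powRr1 ?(ltW u0) // ler_pM2r //.
have [p1|p1] := leP 0 (p - 1).
  by rewrite powRr0 -[leRHS](powRr0 u); apply: ger_powR; rewrite ?u0.
rewrite -(opprB 1 p) !powRN lef_pV2 ?posrE ?powR_gt0 //.
by apply: ge0_ler_powR; rewrite ?nnegrE ?(ltW u0) ?(ltW xn0) //; lra.
Qed.

Lemma cmod_gtilde_powR_le (R : realType) (p x : R) (n : nat) :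
  (0 < n)%N -> 0 < x -> x <= 1 ->
  2 * cmod (gtilde n x%:C) `^ p <=
  n%:R `^ (p - 1) * (Ctilde_integrand p (x ^+ n) * (n%:R * x ^+ n.-1)).
Proof.
move=> n0 x0 x1; rewrite cmod_gtilde gtr0_norm //.
have nR : 0 < n%:R :> R by rewrite ltr0n.
have d0 : 0 < (x ^+ n) ^+ 2 + 1 by rewrite ltr_wpDl // sqr_ge0.
have u0 : 0 < x ^+ n.-1 by exact: exprn_gt0.
rewrite powRM ?invr_ge0 ?sqrtr_ge0 ?mulr_ge0 ?(ltW u0) //.
rewrite powRM ?(ltW u0) // -powR_inv1 ?sqrtr_ge0 // -powR12_sqrt ?(ltW d0) //.
rewrite -!powRrM (_ : 2^-1 * (-1 * p) = - (p / 2)); last by field.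
rewrite powRN.
have -> : n%:R `^ p = n%:R `^ (p - 1) * n%:R :> R.
  by rewrite -{1}[p](subrK 1) (@powRD _ _ (p - 1) 1) ?(gt_eqF nR) ?implybT // powRr1.
rewrite /Ctilde_integrand.
set D := (_ `^ (p / 2))^-1; have D0 : 0 < D by rewrite invr_gt0 powR_gt0.
have := powR_exprn_le p n0 x0 x1.
set A := _ `^ p; set B := _ `^ _; set u := x ^+ n.-1; set N := n%:R `^ _ => AB.
rewrite (_ : 2 * _ = (2 * N * n%:R * D) * A); last by ring.
rewrite (_ : N * _ = (2 * N * n%:R * D) * (B * u)); last by ring.
by rewrite ler_wpM2l // !mulr_ge0 ?powR_ge0 // (ltW D0).
Qed.

Lemma int_pow_gtilde (R : realType) (p : R) (n : nat) : (0 < n)%N ->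
  (int_pow p (@gtilde R n) <= Ctilde p * (n%:R `^ (p - 1))%:E)%E.
Proof.
move=> n0; apply: integral_even_le.
- apply: (measurableT_comp (measurable_powR p)).
  apply: continuous_measurable_fun; exact: continuous_cmod_gtilde.
- by move=> x; exact: powR_ge0.
- by move=> x; rewrite cmod_gtildeN.
- move=> x x0; apply: continuous_powR_comp; first exact: continuous_cmod_gtilde.
  exact: cmod_gtilde_gt0.
move=> a a0 a1.
have N0 : (0 <= (n%:R `^ (p - 1) : R)%:E)%E by rewrite lee_fin powR_ge0.
rewrite muleC.
apply: le_trans (lee_wpmul2l N0 (integral_Ctilde_integrand_exprn p n0 a0 a1)).
have mg : measurable_fun `[a, 1]
    (fun x : R => (Ctilde_integrand p (x ^+ n) * (n%:R * x ^+ n.-1))%:E).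
  apply/measurable_EFinP; apply: measurable_funM.
    by apply: (measurableT_comp (measurable_Ctilde_integrand p)).
  by apply: measurable_funM.
rewrite -ge0_integralZl //; last first.
  move=> x; rewrite /= in_itv /= => /andP[ax _].
  have x0 : 0 <= x by lra.
  by rewrite lee_fin mulr_ge0 ?Ctilde_integrand_ge0 // mulr_ge0 // exprn_ge0.
apply: ge0_le_integral => //.
- by move=> x _; rewrite lee_fin mulr_ge0 // powR_ge0.
- apply/measurable_EFinP; apply: measurable_funM => //.
  apply: (measurable_funS measurableT) => //.
  apply: (measurableT_comp (measurable_powR p)).
  apply: continuous_measurable_fun; exact: continuous_cmod_gtilde.
- exact: measurable_funeM.
move=> x; rewrite /= in_itv /= => /andP[ax x1].
rewrite -EFinM lee_fin.
by apply: cmod_gtilde_powR_le => //; lra.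
Qed.

(** * Upper bounds for the sums of simple fractions *)

Lemma int_pow_ext (R : realType) (p : R) (g h : R[i] -> R[i]) :
  (forall x : R, g x%:C = h x%:C) -> int_pow p g = int_pow p h.
Proof. by move=> gh; apply: eq_integral => x _; rewrite gh. Qed.

Lemma meas_large_ext (R : realType) (c : R) (g h : R[i] -> R[i]) :
  (forall x : R, g x%:C = h x%:C) -> meas_large c g = meas_large c h.
Proof.
move=> gh; congr (lebesgue_measure _).
by apply/seteqP; split => x /=; rewrite gh.
Qed.

Lemma Ctilde_fineK (R : realType) (p : R) : 0 < p ->
  (fine (Ctilde p))%:E = Ctilde p.
Proof.
move=> p0; rewrite fineK // ge0_fin_numE ?Ctilde_lty //.
by apply: integral_ge0 => t _; rewrite lee_fin Ctilde_integrand_ge0.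
Qed.

Theorem mainTheorem4 (R : realType) :
  [/\ (forall n : nat, (1 <= n)%N ->
        exists z : 'I_n -> R[i], unimodular z /\
          forall w : R[i], w ^+ n + (0 +i* 1) != 0 -> gtilde n w = pole_sum z w),
      (forall p : R, 0 < p ->
        (Ctilde p < +oo)%E /\
        forall n : nat, (1 <= n)%N ->
          (int_pow p (@gtilde R n) <= Ctilde p * (n%:R `^ (p - 1))%:E)%E),
      (forall delta : R, 0 < delta -> delta < 1 / 2 ->
        0 < Ktilde delta /\
        forall n : nat, (1 <= n)%N ->
          (meas_large (delta * n%:R) (@gtilde R n)
             < (Ktilde delta * n%:R^-1)%:E)%E),
      (forall (p : R) (a : nat -> R), 0 < p ->
        (forall n : nat, (1 <= n)%N ->
          forall z : 'I_n -> R[i], unimodular z ->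
            ((a n)%:E <= int_pow p (pole_sum z))%E) ->
        exists C : R, forall n : nat, (1 <= n)%N ->
          a n <= C * n%:R `^ (p - 1)) &
      (forall (delta : R) (a : nat -> R), 0 < delta -> delta < 1 / 2 ->
        (forall n : nat, (1 <= n)%N ->
          forall z : 'I_n -> R[i], unimodular z ->
            ((a n)%:E <= meas_large (delta * n%:R) (pole_sum z))%E) ->
        exists C : R, forall n : nat, (1 <= n)%N ->
          a n <= C * n%:R^-1)].
Proof.
split.
- by move=> n; exact: gtilde_pole_sum.
- move=> p p0; split; first exact: Ctilde_lty.
  by move=> n; exact: int_pow_gtilde.
- move=> delta d0 d1; split; first exact: Ktilde_gt0.
  by move=> n; exact: meas_large_gtilde.
- move=> p a p0 ap; exists (fine (Ctilde p)) => n n0.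
  have [z [z1 gz]] := gtilde_pole_sum R n0.
  rewrite -lee_fin EFinM Ctilde_fineK //.
  apply: le_trans (ap n n0 z z1) _.
  rewrite -(@int_pow_ext _ _ (@gtilde R n)) => [|x]; first exact: int_pow_gtilde.
  by apply: gz; exact: real_not_pole.
- move=> delta a d0 d1 ad; exists (Ktilde delta) => n n0.
  have [z [z1 gz]] := gtilde_pole_sum R n0.
  rewrite -lee_fin; apply: le_trans (ad n n0 z z1) _.
  rewrite -(@meas_large_ext _ _ (@gtilde R n)) => [|x].
    by apply: ltW; exact: meas_large_gtilde.
  by apply: gz; exact: real_not_pole.
Qed.
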